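(* Let $\vec{v}\in\mathbb{R}^3$ be a unit vector and let $\Sigma$ be a non-cylindrical ruled surface in $\mathbb{R}^3$. Then $\Sigma$ is a $\lambda$-translator with speed $\vec{v}$ for some $\lambda\in\mathbb{R}$ if and only if $\Sigma$ is a tangent surface whose base curve is a general helix with axis $\vec{v}$. Moreover, whenever $\Sigma$ is a $\lambda$-translator with speed $\vec{v}$, its Gauss curvature satisfies $K=0$, and $\lambda\neq0$, $\lambda\in[-1,1]$.
   Context: Let $\vec{v}\in\mathbb{R}^3$ with $|\vec{v}|=1$ and $\lambda\in\mathbb{R}$. An oriented surface $\Sigma$ immersed in Euclidean space $\mathbb{R}^3$, with unit normal $N$ and Gauss curvature $K$, is a $\lambda$-translator with speed $\vec{v}$ if $K=\langle N,\vec{v}\rangle+\lambda$ at every (regular) point of $\Sigma$. A ruled surface is parametrized by $\Psi(s,t)=\gamma(s)+t\,w(s)$, $s\in I\subset\mathbb{R}$, $t\in\mathbb{R}$, where $I$ is an interval, the base curve $\gamma:I\to\mathbb{R}^3$ is smooth and parametrized by arc-length, and $w$ is a smooth unit vector field along $\gamma$ giving the direction of the rulings. It is cylindrical if all rulings are parallel; planes count as cylindrical surfaces. For a non-cylindrical ruled surface the paper's convention is that $w'(s)\neq0$ for all $s\in I$, that the base curve $\gamma$ (still parametrized by arc-length) is the striction line, i.e. $\langle\gamma'(s),w'(s)\rangle=0$ for all $s\in I$, and that the surface is not (part of) a plane. Such a ruled surface is a tangent surface if $w(s)$ is parallel to $\gamma'(s)$ for all $s$. A general helix with axis $\vec{v}$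 is a curve whose tangent vector makes a constant angle with $\vec{v}$ (equivalently, for non-vanishing curvature, whose principal normal is orthogonal to $\vec{v}$). *)

(* Defs.v *)
From mathcomp Require Import all_boot all_order all_algebra.
From mathcomp Require Import all_classical all_reals all_analysis.

Set Implicit Arguments.
Unset Strict Implicit.
Unset Printing Implicit Defensive.

Import Order.TTheory GRing.Theory Num.Theory.
Import numFieldNormedType.Exports.

Local Open Scope classical_set_scope.
Local Open Scope ring_scope.

Section Euclid.
Variable R : realType.
Local Notation V := 'rV[R]_3.

Definition dot (u v : V) : R := \sum_i u 0 i * v 0 i.

(* The library norm `|u| on 'rV[R]_3 is the sup norm, hence a separate
   Euclidean norm; both induce the same topology. *)
Definition enorm (u : V) : R := Num.sqrt (dot u u).

(* Indices are added modulo 3. *)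
Definition cross (u v : V) : V :=
  \row_(i < 3) (u 0 (i + 1) * v 0 (i + 2%:R) - u 0 (i + 2%:R) * v 0 (i + 1)).

Definition angle (u v : V) : R := acos (dot u v / (enorm u * enorm v)).

End Euclid.

Section Surfaces.
Variable R : realType.
Local Notation V := 'rV[R]_3.

(* For an interval with end points, smoothness up to the end points means that
   f is smooth on an open neighbourhood, so that the two-sided derivatives at
   the end points make sense and are determined by f on the interval. *)
Definition smooth_on (I : set R) (f : R -> V) : Prop :=
  exists U : set R, [/\ open U, I `<=` U &
    forall (n : nat) (s : R), U s -> derivable (derive1n n f) s 1].

Definition partial1 (X : R * R -> V) (p : R * R) : V :=
  derive1 (fun s => X (s, p.2)) p.1.

Definition partial2 (X : R * R -> V) (p : R * R) : V :=
  derive1 (fun t => X (p.1, t)) p.2.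

Definition regular_points (D : set (R * R)) (X : R * R -> V) : set (R * R) :=
  [set p | D p /\ cross (partial1 X p) (partial2 X p) != 0].

Definition param_normal (X : R * R -> V) (p : R * R) : V :=
  let n := cross (partial1 X p) (partial2 X p) in (enorm n)^-1 *: n.

Definition gauss_curvature (X : R * R -> V) (p : R * R) : R :=
  let n := param_normal X p in
  let E := dot (partial1 X p) (partial1 X p) in
  let F := dot (partial1 X p) (partial2 X p) in
  let G := dot (partial2 X p) (partial2 X p) in
  let e := dot (partial1 (partial1 X) p) n in
  let f := dot (partial2 (partial1 X) p) n in
  let g := dot (partial2 (partial2 X) p) n in
  (e * g - f ^+ 2) / (E * G - F ^+ 2).

(* An orientation of the regular part: N is +/- param_normal X, with a sign
   that is locally constant but may differ between connected components. *)
Definition orientation (D : set (R * R)) (X N : R * R -> V) : Prop :=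
  {within regular_points D X, continuous N} /\
  forall p, regular_points D X p ->
    [/\ enorm (N p) = 1, dot (N p) (partial1 X p) = 0 &
        dot (N p) (partial2 X p) = 0].

Definition translator (D : set (R * R)) (X N : R * R -> V) (v : V) (lam : R) :
    Prop :=
  orientation D X N /\
  forall p, regular_points D X p -> gauss_curvature X p = dot (N p) v + lam.

Definition ruled (gamma w : R -> V) (p : R * R) : V :=
  gamma p.1 + p.2 *: w p.1.

Definition ruled_domain (I : set R) : set (R * R) := I `*` setT.

Definition nondegenerate_interval (I : set R) : Prop :=
  is_interval I /\ exists a b, [/\ I a, I b & a < b].

Definition in_plane (S : set V) : Prop :=
  exists (n : V) (c : R), n != 0 /\ forall x, S x -> dot x n = c.

Definition noncylindrical_ruled (I : set R) (gamma w : R -> V) : Prop :=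
  [/\ nondegenerate_interval I,
      smooth_on I gamma /\ smooth_on I w,
      forall s, I s -> enorm (derive1 gamma s) = 1 /\ enorm (w s) = 1,
      forall s, I s ->
        derive1 w s != 0 /\ dot (derive1 gamma s) (derive1 w s) = 0 &
      ~ in_plane (ruled gamma w @` ruled_domain I)].

Definition tangent_surface (I : set R) (gamma w : R -> V) : Prop :=
  forall s, I s -> exists c : R, w s = c *: derive1 gamma s.

Definition general_helix (I : set R) (gamma : R -> V) (v : V) : Prop :=
  exists theta : R, forall s, I s -> angle (derive1 gamma s) v = theta.

End Surfaces.

(* Main.v *)
Require Import Defs.
From mathcomp Require Import all_boot all_order all_algebra.
From mathcomp Require Import all_classical all_reals all_analysis.
From mathcomp Require Import ring lra.
Import Order.TTheory GRing.Theory Num.Theory.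
Import numFieldNormedType.Exports.
Local Open Scope classical_set_scope.
Local Open Scope ring_scope.

Set Implicit Arguments.
Unset Strict Implicit.
Unset Printing Implicit Defensive.

(** Write X(s,t) = gamma(s) + t w(s). On the striction line gamma' x w and
    w' x w are orthogonal, so X_s x X_t = gamma' x w + t w' x w has squared
    length P(t) = A + B t^2 with A = |gamma' x w|^2 and B = |w'|^2 > 0, and
    the Gauss curvature is - A B / P^2. The normal component of v is
    (a + b t) / sqrt P up to sign, with a and b depending on s only. Squaring
    the translator equation along one ruling gives a polynomial identity in t,
      (A B + lam P^2)^2 = P^3 (a + b t)^2,
    in which P divides the constant (A B)^2; hence A B = 0 and gamma' x w = 0
    ([translator_cross_eq0]). A translator is therefore a tangent surface, it
    is flat, and its normal is, up to sign, the binormal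
    e = (w x w') / |w'|, which must satisfy <e,v>^2 = lam^2.

    What remains concerns the spherical curve w with its moving frame w, w', e.
    Differentiating e gives e' = - kappa w', where kappa = <e,w''> / |w'|^2 is
    the geodesic curvature of w. Since <e,v> is constant up to sign,
    kappa <w',v> = 0. This alone does not make <w,v> constant, because kappa
    might vanish on part of the interval. However, where kappa <> 0 one may
    differentiate <w',v> = 0 once more and find kappa <e,v> = <w,v>, hence
    lam^2 kappa^2 = 1 - lam^2. So kappa^2 takes at most the two values 0 and
    (1 - lam^2) / lam^2 and, being differentiable on an interval, is constant
    ([nongeodesic_level]). If kappa = 0 identically, then e is constant and the
    surface lies in a plane, which is excluded
    ([tangent_geodesic_planar]). Otherwise kappa never vanishes, <w,v> is
    constant, which is the helix condition, and
    lam^2 (1 + kappa^2) = 1 gives 0 < lam^2 <= 1.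

    Conversely, on a tangent surface over a helix <w',v> = 0, so
    <e,v>' = - kappa <w',v> = 0: with N = e the translator equation holds for
    lam = - <e,v> ([tangent_helix_translator]). *)

(** * Vector algebra in three dimensions *)

Section VectorAlgebra.
Context {R : realType}.
Local Notation V := 'rV[R]_3.
Implicit Types (a b c u v x y N : V) (k : R).

Lemma dotE u v :
  dot u v = u 0 0 * v 0 0 + u 0 1 * v 0 1 + u 0 2%:R * v 0 2%:R.
Proof.
by rewrite /dot !big_ord_recl big_ord0 addr0 addrA;
  do ![congr (_ + _)]; congr (u 0 _ * v 0 _); apply: val_inj.
Qed.

Lemma cross0E u v :
  cross u v 0 0 = u 0 1 * v 0 2%:R - u 0 2%:R * v 0 1.
Proof. by rewrite mxE !add0r. Qed.

Lemma cross1E u v :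
  cross u v 0 1 = u 0 2%:R * v 0 0 - u 0 0 * v 0 2%:R.
Proof.
have e : 1 + 2%:R = 0 :> 'I_3 by apply: val_inj.
by rewrite mxE e.
Qed.

Lemma cross2E u v :
  cross u v 0 2%:R = u 0 0 * v 0 1 - u 0 1 * v 0 0.
Proof.
have e : 2%:R + 1 = 0 :> 'I_3 by apply: val_inj.
have f : 2%:R + 2%:R = 1 :> 'I_3 by apply: val_inj.
by rewrite mxE e f.
Qed.

Lemma row3P u v :
  u 0 0 = v 0 0 -> u 0 1 = v 0 1 -> u 0 2%:R = v 0 2%:R -> u = v.
Proof.
move=> h0 h1 h2; apply/rowP => -[[|[|[|//]]] i].
- by have -> : Ordinal i = 0 by apply: val_inj.
- by have -> : Ordinal i = 1 by apply: val_inj.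
- by have -> : Ordinal i = 2%:R by apply: val_inj.
Qed.

Definition coordE := (dotE, cross0E, cross1E, cross2E, mxE).

Lemma dotC u v : dot u v = dot v u.
Proof. by rewrite !dotE; ring. Qed.

Lemma dotDl u v x : dot (u + v) x = dot u x + dot v x.
Proof. by rewrite !coordE; ring. Qed.

Lemma dotBl u v x : dot (u - v) x = dot u x - dot v x.
Proof. by rewrite !coordE; ring. Qed.

Lemma dotZl k u x : dot (k *: u) x = k * dot u x.
Proof. by rewrite !coordE; ring. Qed.

Lemma dotDr u v x : dot x (u + v) = dot x u + dot x v.
Proof. by rewrite !coordE; ring. Qed.

Lemma dotZr k u x : dot x (k *: u) = k * dot x u.
Proof. by rewrite !coordE; ring. Qed.

Lemma dot0l x : dot 0 x = 0.
Proof. by rewrite !coordE; ring. Qed.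

Lemma dot_ge0 u : 0 <= dot u u.
Proof. by rewrite dotE !addr_ge0// -expr2 sqr_ge0. Qed.

Lemma dot_eq0 u : (dot u u == 0) = (u == 0).
Proof.
apply/eqP/eqP => [|->]; last by rewrite dot0l.
rewrite dotE -!expr2 => h.
have h0 := sqr_ge0 (u 0 0); have h1 := sqr_ge0 (u 0 1).
have h2 := sqr_ge0 (u 0 2%:R).
apply: row3P; rewrite mxE; apply/eqP; rewrite -sqrf_eq0; apply/eqP; lra.
Qed.

Lemma dot_gt0 u : (0 < dot u u) = (u != 0).
Proof. by rewrite lt_def dot_ge0 andbT dot_eq0. Qed.

Lemma sqr_enorm u : enorm u ^+ 2 = dot u u.
Proof. by rewrite sqr_sqrtr ?dot_ge0. Qed.

Lemma enorm1_dot u : enorm u = 1 -> dot u u = 1.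
Proof. by rewrite -sqr_enorm => ->; rewrite expr1n. Qed.

Lemma dot1_enorm u : dot u u = 1 -> enorm u = 1.
Proof. by rewrite /enorm => ->; rewrite sqrtr1. Qed.

Lemma dot_crossl a b : dot (cross a b) a = 0.
Proof. by rewrite !coordE; ring. Qed.

Lemma dot_crossr a b : dot (cross a b) b = 0.
Proof. by rewrite !coordE; ring. Qed.

Lemma crossDl a b c : cross (a + b) c = cross a c + cross b c.
Proof. by apply: row3P; rewrite !coordE; ring. Qed.

Lemma crossZl k a b : cross (k *: a) b = k *: cross a b.
Proof. by apply: row3P; rewrite !coordE; ring. Qed.

Lemma crossC a b : cross a b = - cross b a.
Proof. by apply: row3P; rewrite !coordE; ring. Qed.

Lemma dot_cross_cross a b :
  dot (cross a b) (cross a b) = dot a a * dot b b - dot a b ^+ 2.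
Proof. by rewrite !coordE; ring. Qed.

Lemma cross_cross a b x :
  cross (cross a b) x = dot a x *: b - dot b x *: a.
Proof. by apply: row3P; rewrite !coordE; ring. Qed.

Lemma dot_cross_crossr a b c :
  dot (cross a c) (cross b c) = dot a b * dot c c - dot a c * dot b c.
Proof. by rewrite !coordE; ring. Qed.

Lemma cross_parallel k a : cross a (k *: a) = 0.
Proof. by apply: row3P; rewrite !coordE; ring. Qed.

Lemma dotNl a b : dot (- a) b = - dot a b.
Proof. by rewrite !coordE; ring. Qed.

(** Product of two mixed products as the Gram determinant of (x,a,b) against
    (y,a,b); it yields the expansion of <x,y> in the frame a, b, a x b. *)
Lemma gram3 a b x y :
  dot x (cross a b) * dot y (cross a b) =
  dot x y * (dot a a * dot b b - dot a b ^+ 2)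
  - dot x a * (dot a y * dot b b - dot a b * dot b y)
  + dot x b * (dot a y * dot a b - dot a a * dot b y).
Proof. by rewrite !coordE; ring. Qed.

(** Apply [cross_cross] to (a x b) x N = 0 and multiply once more by N. *)
Lemma cross_normal a b N :
  dot N N = 1 -> dot N a = 0 -> dot N b = 0 ->
  cross a b = dot (cross a b) N *: N.
Proof.
move=> N1 Na Nb.
have h : cross (cross a b) N = 0.
  by rewrite cross_cross dotC Na dotC Nb !scale0r subr0.
move: (cross_cross (cross a b) N N); rewrite h N1 scale1r.
have -> : cross 0 N = 0 by apply: row3P; rewrite !coordE; ring.
by move/esym/eqP; rewrite subr_eq0 => /eqP ->.
Qed.

(** Squaring removes the sign by which N may differ from the normalized
    cross product. *)
Lemma sqr_dot_normal a b N v :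
  dot N N = 1 -> dot N a = 0 -> dot N b = 0 ->
  dot N v ^+ 2 * dot (cross a b) (cross a b) = dot (cross a b) v ^+ 2.
Proof.
move=> N1 Na Nb; have := cross_normal N1 Na Nb.
by set c := cross a b; set k := dot c N => ->; rewrite !dotZl !dotZr N1; ring.
Qed.

Lemma cross0_parallel u v :
  dot u u = 1 -> cross u v = 0 -> v = dot u v *: u.
Proof.
move=> u1 uv0.
move: (cross_cross u v u); rewrite uv0 u1 scale1r.
have -> : cross 0 u = 0 by apply: row3P; rewrite !coordE; ring.
by move/esym/eqP; rewrite subr_eq0 => /eqP{1}->; rewrite dotC.
Qed.

Lemma angle_unit u v :
  dot u u = 1 -> dot v v = 1 -> angle u v = acos (dot u v).
Proof. by move=> /dot1_enorm u1 /dot1_enorm v1; rewrite /angle u1 v1 mulr1 divr1. Qed.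

Lemma cos_angle_unit u v :
  dot u u = 1 -> dot v v = 1 -> cos (angle u v) = dot u v.
Proof.
move=> u1 v1; rewrite angle_unit// acosK// in_itv/= -ler_norml.
rewrite -(@expr_le1 _ 2)// real_normK ?num_real//.
have := dot_ge0 (cross u v); rewrite dot_cross_cross u1 v1; lra.
Qed.

End VectorAlgebra.

(** * Calculus along an interval *)

Section Calculus.
Context {R : realType}.
Local Notation V := 'rV[R]_3.
Implicit Types (f g : R -> V) (s : R).

Lemma derivable_is_derive1 (W : normedModType R) (f : R -> W) s :
  derivable f s 1 -> is_derive s 1 f (derive1 f s).
Proof. by move=> df; rewrite derive1E; exact: derivableP. Qed.

Lemma is_derive_coord f s (df : V) i :
  is_derive s 1 f df -> is_derive s 1 (fun x => f x 0 i) (df 0 i).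
Proof.
move=> [fs <-]; have fsi := (derivable_mxP f s 1).1 fs 0 i.
by apply: DeriveDef => //; rewrite derive_mx// mxE.
Qed.

Lemma is_derive_row f s (df : V) :
  (forall i, is_derive s 1 (fun x => f x 0 i) (df 0 i)) -> is_derive s 1 f df.
Proof.
move=> h; have fs : derivable f s 1.
  by apply/derivable_mxP => i j; rewrite ord1; case: (h j).
apply: DeriveDef => //; rewrite derive_mx//.
by apply/rowP => i; rewrite mxE; case: (h i).
Qed.

Lemma is_derive_mul (f g : R -> R) s df dg :
  is_derive s 1 f df -> is_derive s 1 g dg ->
  is_derive s 1 (fun x => f x * g x) (df * g s + f s * dg).
Proof.
by move=> hf hg; apply: is_derive_eq (is_deriveM hf hg) _; rewrite addrC mulrC.
Qed.

Lemma is_derive_dot f g s (df dg : V) :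
  is_derive s 1 f df -> is_derive s 1 g dg ->
  is_derive s 1 (fun x => dot (f x) (g x)) (dot df (g s) + dot (f s) dg).
Proof.
move=> hf hg; rewrite (_ : (fun x => _) = fun x => f x 0 0 * g x 0 0 +
  f x 0 1 * g x 0 1 + f x 0 2%:R * g x 0 2%:R); last first.
  by apply/funext => x; rewrite dotE.
have h i := is_derive_mul (is_derive_coord i hf) (is_derive_coord i hg).
apply: is_derive_eq (is_deriveD (is_deriveD (h 0) (h 1)) (h 2%:R)) _.
by rewrite !dotE; ring.
Qed.

Lemma is_derive_cross f g s (df dg : V) :
  is_derive s 1 f df -> is_derive s 1 g dg ->
  is_derive s 1 (fun x => cross (f x) (g x)) (cross df (g s) + cross (f s) dg).
Proof.
move=> hf hg; apply: is_derive_row => i.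
have h j k := is_derive_mul (is_derive_coord j hf) (is_derive_coord k hg).
rewrite (_ : (fun x => _) = fun x => f x 0 (i + 1) * g x 0 (i + 2%:R) -
  f x 0 (i + 2%:R) * g x 0 (i + 1)); last by apply/funext => x; rewrite mxE.
apply: is_derive_eq (is_deriveB (h _ _) (h _ _)) _.
by rewrite !mxE; ring.
Qed.

Lemma is_derive_scale (k : R -> R) f s dk (df : V) :
  is_derive s 1 k dk -> is_derive s 1 f df ->
  is_derive s 1 (fun x => k x *: f x) (dk *: f s + k s *: df).
Proof.
move=> hk hf; apply: is_derive_row => i.
rewrite (_ : (fun x => _) = fun x => k x * f x 0 i); last first.
  by apply/funext => x; rewrite mxE.
apply: is_derive_eq (is_derive_mul hk (is_derive_coord i hf)) _.
by rewrite !mxE.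
Qed.

Lemma is_derive_dot_const f s (df v : V) :
  is_derive s 1 f df -> is_derive s 1 (fun x => dot (f x) v) (dot df v).
Proof.
move=> hf; apply: is_derive_eq (is_derive_dot hf (is_derive_cst v s 1)) _.
by rewrite [dot _ 0]dotC dot0l addr0.
Qed.

Lemma is_derive_continuous (W : normedModType R) (f : R -> W) s df :
  is_derive s 1 f df -> {for s, continuous f}.
Proof.
by move=> [fs _]; apply: differentiable_continuous; exact/derivable1_diffP.
Qed.

(** Derivatives are two-sided, while the hypotheses only constrain functions on
    I. Every point of a nondegenerate interval, end points included, is a
    limit of other points of I, and these determine the derivative. *)
Lemma is_derive_eq_within (I : set R) (f g : R -> R) s df dg :
  nondegenerate_interval I -> I s ->
  is_derive s 1 f df -> is_derive s 1 g dg ->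
  (\forall x \near s, I x -> f x = g x) -> df = dg.
Proof.
move=> [itv [a [b [Ia Ib ab]]]] Is hf hg fg.
have [hs hd] := is_deriveB hf hg.
apply/eqP; rewrite -subr_eq0 -{}hd; apply/negPn/negP => l0.
set l := 'D_1 _ s in l0.
have e0 : 0 < `|l| by rewrite normr_gt0.
have hfs := nbhs_singleton fg Is.
have : \forall h \near (0:R)^',
    `|l - h^-1 *: ((f \- g) (h *: 1 + s) - (f \- g) s)| < `|l|.
  have : (h^-1 *: ((f \- g) (h *: 1 + s) - (f \- g) s)) @[h --> (0:R)^'] --> l.
    exact: hs.
  by move/cvgrPdist_lt => /(_ _ e0).
rewrite near_withinE => /nbhs_ballP[d1 /= d10 h1].
case/nbhs_ballP: fg => d2 /= d20 h2.
have bad t : t != 0 -> `|t| < d1 -> `|t| < d2 -> ~ I (s + t).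
  move=> t0 t1 t2 It.
  have := h1 t; rewrite /ball/= sub0r normrN => /(_ t1 t0).
  have -> : t *: 1 + s = s + t by rewrite addrC [_ *: 1]mulr1.
  have : f (s + t) = g (s + t).
    by apply: h2 => //; rewrite /ball/= opprD addrA subrr sub0r normrN.
  by move=> /= ->; rewrite hfs !subrr scaler0 subr0 ltxx.
set d := Num.min d1 d2 / 2.
have d0 : 0 < d by rewrite divr_gt0// lt_min d10.
have dd : d < d1 /\ d < d2.
  by apply/andP; rewrite -lt_min ltr_pdivrMr// ltr_pMr ?lt_min ?d10// ltr1n.
have [sb|bs] := ltP s b.
- pose t := Num.min d (b - s).
  have t0 : 0 < t by rewrite lt_min d0 subr_gt0.
  have td : t <= d by rewrite ge_min lexx.
  have tb : t <= b - s by rewrite ge_min lexx orbT.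
  apply: (@bad t); rewrite ?gt_eqF// ?gtr0_norm//.
  + exact: le_lt_trans dd.1.
  + exact: le_lt_trans dd.2.
  + by apply: (itv s b) => //; apply/andP; split; lra.
- pose t := Num.min d (s - a).
  have t0 : 0 < t by rewrite lt_min d0 subr_gt0 (lt_le_trans ab).
  have td : t <= d by rewrite ge_min lexx.
  have tb : t <= s - a by rewrite ge_min lexx orbT.
  apply: (@bad (- t)); rewrite ?oppr_eq0 ?gt_eqF// ?normrN ?gtr0_norm//.
  + exact: le_lt_trans dd.1.
  + exact: le_lt_trans dd.2.
  + by apply: (itv a s) => //; apply/andP; split; lra.
Qed.

Lemma is_derive_within_const (I : set R) (f : R -> R) s df c :
  nondegenerate_interval I -> I s -> is_derive s 1 f df ->
  (forall x, I x -> f x = c) -> df = 0.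
Proof.
move=> hI Is hf fc.
apply: (is_derive_eq_within hI Is hf (is_derive_cst c s 1)).
by near=> x => /fc.
Unshelve. all: by end_near.
Qed.

Lemma derive0_const (I : set R) (f : R -> R) :
  is_interval I -> (forall s, I s -> is_derive s 1 f 0) ->
  forall x y, I x -> I y -> f x = f y.
Proof.
move=> itv hf.
suff h x y : x <= y -> I x -> I y -> f x = f y.
  by move=> x y Ix Iy; have [xy|/ltW yx] := leP x y; [exact: h|exact/esym/h].
move=> xy Ix Iy; have Ixy z : z \in `[x, y] -> I z.
  by rewrite in_itv/= => /andP[xz zy]; apply: (itv x y) => //; apply/andP.
have [z zI|| c _] := @MVT_segment _ f (fun=> 0) x y xy.
- exact/hf/Ixy/subset_itv_oo_cc.
- by apply: derivable_within_continuous => z /Ixy/hf[].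
- by rewrite mul0r => /eqP; rewrite subr_eq0 => /eqP.
Qed.

(** From f f' = 0: either the constant is nonzero and so is f, or f vanishes
    on the whole of I. This recovers f' = 0 although the square determines
    f only up to a sign at each point. *)
Lemma derive_of_const_sqr (I : set R) (f : R -> R) s df c :
  nondegenerate_interval I -> I s -> is_derive s 1 f df ->
  (forall x, I x -> f x ^+ 2 = c) -> df = 0.
Proof.
move=> hI Is hf fc.
have [c0|c0] := eqVneq c 0.
  apply: (is_derive_within_const hI Is hf (c := 0)) => x Ix.
  by apply/eqP; rewrite -sqrf_eq0 fc// c0.
have := is_derive_within_const hI Is (is_derive_mul hf hf) (c := c).
rewrite mulrC -mulr2n => /(_ _)/eqP; rewrite mulrn_eq0/= mulf_eq0.
move=> h; have {h} : (f s == 0) || (df == 0) by apply: h => x Ix; rewrite -expr2 fc.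
case/orP => /eqP // fs0; move: c0; rewrite -(fc s Is) fs0 expr0n/= eqxx //.
Qed.

End Calculus.

(** * The polynomial identity along a ruling *)

Lemma horner_eq0_poly0 (R : numDomainType) (p : {poly R}) :
  (forall t, p.[t] = 0) -> p = 0.
Proof.
move=> h; apply/eqP/negPn/negP => p0.
have := max_poly_roots p0 (rs := mkseq (fun i => i%:R) (size p)).
rewrite size_mkseq ltnn => H; apply/notF/H.
- by apply/allP => x _; rewrite rootE h.
- by apply: mkseq_uniq => i j /eqP; rewrite eqr_nat => /eqP.
Qed.

(** With P = A + B t^2, all terms of the identity other than D^2 are multiples
    of P; as P has degree 2, it can divide the constant D^2 only if D = 0. *)
Lemma translator_polynomial (R : numFieldType) (A B D a b lam : R) :
  B != 0 ->
  (forall t, (D + lam * (A + B * t ^+ 2) ^+ 2) ^+ 2 =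
     (A + B * t ^+ 2) ^+ 3 * (a + b * t) ^+ 2) ->
  D = 0.
Proof.
move=> B0 h; pose p : {poly R} := B *: 'X^2 + A%:P.
have sp : size p = 3%N.
  by rewrite size_polyDl size_scale// size_polyXn// (leq_ltn_trans (size_polyC_leq1 _)).
pose r : {poly R} := p ^+ 2 * (b *: 'X + a%:P) ^+ 2
  - (lam ^+ 2) *: p ^+ 3 - (2 * D * lam) *: p.
have pr : p * r = (D ^+ 2)%:P.
  apply/eqP; rewrite -subr_eq0; apply/eqP/horner_eq0_poly0 => t.
  have /eqP := h t; rewrite eq_sym -subr_eq0 => /eqP ht.
  by rewrite !hornerE -[RHS]ht /=; ring.
have [r0|r0] := eqVneq r 0.
  move/polyP : pr => /(_ 0%N); rewrite r0 mulr0 coefC coef0 /= => /esym/eqP.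
  by rewrite sqrf_eq0 => /eqP.
have p0 : p != 0 by rewrite -size_poly_eq0 sp.
have := size_polyC_leq1 (D ^+ 2); rewrite -pr size_mul// sp.
by rewrite -size_poly_gt0 in r0; case: (size r) r0.
Qed.

(** * Spherical curves and their binormal *)

(** The direction field w of the rulings as a curve on the unit sphere. The
    derivatives are named functions w1, w2 instead of [derive1] terms, which
    keeps rewriting from unfolding limits. *)
Record unit_field (R : realType) (I : set R) (w w1 w2 : R -> 'rV[R]_3) : Prop :=
  UnitField {
    uf_interval : nondegenerate_interval I;
    uf_unit : forall s, I s -> dot (w s) (w s) = 1;
    uf_neq0 : forall s, I s -> w1 s != 0;
    uf_derive : forall s, I s -> is_derive s 1 w (w1 s);
    uf_derive1 : forall s, I s -> is_derive s 1 w1 (w2 s);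
    uf_derivable2 : forall s, I s -> derivable w2 s 1
  }.

Section UnitField.
Context {R : realType} (I : set R) (w w1 w2 : R -> 'rV[R]_3).
Local Notation V := 'rV[R]_3.
Implicit Types (s : R) (v : V).

Definition binormal s : V :=
  (enorm (cross (w s) (w1 s)))^-1 *: cross (w s) (w1 s).

(** Geodesic curvature of the curve w on the unit sphere, in an arbitrary
    regular parametrization. *)
Definition geodesic_curvature s : R :=
  dot (binormal s) (w2 s) / dot (w1 s) (w1 s).

Local Notation e := binormal.
Local Notation kappa := geodesic_curvature.

Hypothesis hw : unit_field I w w1 w2.

Lemma dot_w_w1 s : I s -> dot (w s) (w1 s) = 0.
Proof.
move=> Is; have := is_derive_dot (uf_derive hw Is) (uf_derive hw Is).
move/(is_derive_within_const (uf_interval hw) Is) => /(_ 1 (uf_unit hw)).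
by rewrite dotC => h; lra.
Qed.

Lemma dot_w_w2 s : I s -> dot (w s) (w2 s) = - dot (w1 s) (w1 s).
Proof.
move=> Is; have := is_derive_dot (uf_derive hw Is) (uf_derive1 hw Is).
by move/(is_derive_within_const (uf_interval hw) Is) => /(_ 0 dot_w_w1) h; lra.
Qed.

Lemma dot_cross_w s : I s ->
  dot (cross (w s) (w1 s)) (cross (w s) (w1 s)) = dot (w1 s) (w1 s).
Proof. by move=> Is; rewrite dot_cross_cross (uf_unit hw)// dot_w_w1//; ring. Qed.

Lemma w1_gt0 s : I s -> 0 < dot (w1 s) (w1 s).
Proof. by move=> Is; rewrite dot_gt0 (uf_neq0 hw). Qed.

Lemma dot_binormal_w s : dot (e s) (w s) = 0.
Proof. by rewrite dotZl dot_crossl mulr0. Qed.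

Lemma dot_binormal_w1 s : dot (e s) (w1 s) = 0.
Proof. by rewrite dotZl dot_crossr mulr0. Qed.

Lemma binormal_unit s : I s -> dot (e s) (e s) = 1.
Proof.
move=> Is; rewrite dotZl dotZr mulrA -expr2 exprVn sqr_enorm mulVf//.
by rewrite dot_cross_w// gt_eqF// w1_gt0.
Qed.

(** Parseval identity in the orthonormal frame w, w'/|w'|, e. *)
Lemma frame_expansion s (x y : V) : I s ->
  dot x y = dot x (w s) * dot (w s) y
    + dot x (w1 s) * dot (w1 s) y / dot (w1 s) (w1 s)
    + dot x (e s) * dot (e s) y.
Proof.
move=> Is; have h := gram3 (w s) (w1 s) x y.
rewrite (uf_unit hw)// dot_w_w1// in h.
have n0 : dot (w1 s) (w1 s) != 0 by rewrite gt_eqF// w1_gt0.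
have -> : dot x (e s) * dot (e s) y =
    dot x (cross (w s) (w1 s)) * dot y (cross (w s) (w1 s)) / dot (w1 s) (w1 s).
  rewrite -(dot_cross_w Is) -sqr_enorm dotZr dotZl [dot _ y]dotC.
  rewrite -exprVn; ring.
by rewrite h; field.
Qed.

Lemma binormal_derivable s : I s -> exists de, is_derive s 1 e de.
Proof.
move=> Is; have hB := is_derive_cross (uf_derive hw Is) (uf_derive1 hw Is).
have n0 : 0 < dot (cross (w s) (w1 s)) (cross (w s) (w1 s)).
  by rewrite dot_cross_w// w1_gt0.
have [dn hn] : exists dn, is_derive s 1 (fun r => enorm (cross (w r) (w1 r))) dn.
  by eexists; exact: is_derive1_comp (is_derive1_sqrt n0) (is_derive_dot hB hB).
have n1 : enorm (cross (w s) (w1 s)) != 0 by rewrite sqrtr_eq0 -ltNge.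
pose n r := enorm (cross (w r) (w1 r)).
by eexists; exact: is_derive_scale (is_deriveV (f := n) n1 hn) hB.
Qed.

(** The Frenet-type equation e' = - kappa w', tested against v: differentiating
    |e|^2 = 1, <e,w> = 0 and <e,w'> = 0 gives the coordinates of e' in the
    frame. *)
Lemma is_derive_binormal_dot s v : I s ->
  is_derive s 1 (fun x => dot (e x) v) (- kappa s * dot (w1 s) v).
Proof.
move=> Is; have [de hde] := binormal_derivable Is.
apply: is_derive_eq (is_derive_dot_const v hde) _.
have := is_derive_within_const (uf_interval hw) Is (is_derive_dot hde hde) binormal_unit.
have := is_derive_within_const (uf_interval hw) Is (is_derive_dot hde (uf_derive hw Is))
  (fun x _ => dot_binormal_w x).
have := is_derive_within_const (uf_interval hw) Is (is_derive_dot hde (uf_derive1 hw Is))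
  (fun x _ => dot_binormal_w1 x).
rewrite dot_binormal_w1 addr0 [dot (e s) de]dotC => h1 h0 h2.
rewrite (frame_expansion de v Is) h0.
have -> : dot de (e s) = 0 by lra.
have -> : dot de (w1 s) = - dot (e s) (w2 s) by lra.
by rewrite /geodesic_curvature; ring.
Qed.

Lemma geodesic_curvature_derivable s : I s -> derivable kappa s 1.
Proof.
move=> Is; have [de hde] := binormal_derivable Is.
have n0 : dot (w1 s) (w1 s) != 0 by rewrite gt_eqF// w1_gt0.
have h2 := derivable_is_derive1 (uf_derivable2 hw Is).
by have [] := is_derive_mul (is_derive_dot hde h2)
  (is_deriveV n0 (is_derive_dot (uf_derive1 hw Is) (uf_derive1 hw Is))).
Qed.

Lemma geodesic_binormal_const :
  (forall s, I s -> kappa s = 0) -> forall s t, I s -> I t -> e s = e t.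
Proof.
move=> k0 s t Is It; apply/eqP; rewrite -subr_eq0 -dot_eq0; apply/eqP.
set d := e s - e t.
rewrite {1}/d dotBl; apply/eqP; rewrite subr_eq0; apply/eqP.
apply: (derive0_const (f := fun x => dot (e x) d))
  (uf_interval hw).1 _ _ _ Is It => x Ix.
by apply: is_derive_eq (is_derive_binormal_dot d Ix) _; rewrite k0// oppr0 mul0r.
Qed.

Section ConstantAngle.
Variables (v : V) (c : R).
Hypothesis v_unit : dot v v = 1.
Hypothesis e_angle : forall s, I s -> dot (e s) v ^+ 2 = c.

Lemma geodesic_or_level s : I s -> kappa s * dot (w1 s) v = 0.
Proof.
move=> Is; have := derive_of_const_sqr (uf_interval hw) Is
  (is_derive_binormal_dot v Is) e_angle.
by rewrite mulNr => /eqP; rewrite oppr_eq0 => /eqP.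
Qed.

(** Where kappa does not vanish, neither does it nearby, so <w',v> = 0 nearby
    and also <w'',v> = 0. In the frame this reads kappa <e,v> = <w,v>, and
    then 1 = |v|^2 = <w,v>^2 + <e,v>^2 gives the relation. *)
Lemma sqr_geodesic_curvature s : I s -> kappa s != 0 ->
  dot (w1 s) v = 0 /\ c * kappa s ^+ 2 = 1 - c.
Proof.
move=> Is k0; have kc := geodesic_curvature_derivable Is.
have g0 : \forall x \near s, I x -> dot (w1 x) v = 0.
  have /cvgr_neq0 : kappa x @[x --> s] --> kappa s.
    exact/differentiable_continuous/derivable1_diffP.
  move=> /(_ k0); apply: filterS => x kx Ix; apply/eqP.
  by have /eqP := geodesic_or_level Ix; rewrite mulf_eq0 (negPf kx).
have g1 : dot (w2 s) v = 0.
  exact: is_derive_eq_within (uf_interval hw) Is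
    (is_derive_dot_const v (uf_derive1 hw Is)) (is_derive_cst 0 s 1) g0.
have gs : dot (w1 s) v = 0 by exact: nbhs_singleton g0 Is.
split=> //.
have n0 : dot (w1 s) (w1 s) != 0 by rewrite gt_eqF// w1_gt0.
have k_def : dot (e s) (w2 s) = kappa s * dot (w1 s) (w1 s) by rewrite divfK.
have := frame_expansion (w2 s) v Is; rewrite g1 gs mulr0 mul0r addr0.
rewrite [dot (w2 s) (w s)]dotC dot_w_w2// [dot (w2 s) (e s)]dotC k_def => h.
have /(mulfI n0) hk : dot (w1 s) (w1 s) * (dot (w s) v) =
    dot (w1 s) (w1 s) * (kappa s * dot (e s) v) by lra.
have := frame_expansion v v Is; rewrite v_unit gs mulr0 mul0r addr0.
have ev := e_angle Is; rewrite ![dot v _]dotC hk -!expr2 exprMn ev => h1.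
by rewrite mulrC; lra.
Qed.

(** By [sqr_geodesic_curvature], u = kappa^2 satisfies u (c u - (1 - c)) = 0 on
    the interval. The roots are distinct, since u(s0) is a nonzero one, so
    differentiating this relation forces u' = 0: a nonzero curvature at s0
    persists everywhere. *)
Lemma nongeodesic_level s0 : I s0 -> kappa s0 != 0 ->
  c != 0 /\ forall s, I s -> dot (w1 s) v = 0.
Proof.
move=> Is0 k0; have [_ ck0] := sqr_geodesic_curvature Is0 k0.
have c0 : c != 0.
  by apply/eqP => c0; move: ck0; rewrite c0 mul0r subr0 => /eqP; rewrite eq_sym oner_eq0.
have c1 : 1 - c != 0 by rewrite -ck0 mulf_neq0// sqrf_eq0.
split=> // s Is; suff ks : kappa s ^+ 2 = kappa s0 ^+ 2.
  have ks0 : kappa s != 0 by rewrite -sqrf_eq0 ks sqrf_eq0.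
  by have [] := sqr_geodesic_curvature Is ks0.
apply: (derive0_const (f := fun x => kappa x ^+ 2))
  (uf_interval hw).1 _ _ _ Is Is0 => x Ix.
have hk := derivable_is_derive1 (geodesic_curvature_derivable Ix).
have /= hu := is_derive_mul hk hk.
set du := (X in is_derive _ _ _ X) in hu.
have two_values y : I y -> (kappa y * kappa y) * (c * (kappa y * kappa y) - (1 - c)) = 0.
  move=> Iy; have [->|ky] := eqVneq (kappa y) 0; first by rewrite !mul0r.
  by have [_ <-] := sqr_geodesic_curvature Iy ky; rewrite expr2 subrr mulr0.
have hp := is_derive_mul hu (is_deriveB (is_derive_mul (is_derive_cst c x 1) hu)
  (is_derive_cst (1 - c) x 1)).
have := is_derive_within_const (uf_interval hw) Ix hp two_values.
rewrite mul0r add0r subr0 => h; apply: is_derive_eq hu _.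
have {}h : du * (c * (kappa x * kappa x) - (1 - c))
    + kappa x * kappa x * (c * du) = 0 by exact: h.
have {}h : du * (2 * (c * (kappa x * kappa x)) - (1 - c)) = 0.
  by rewrite -[RHS]h; ring.
move/eqP: h; rewrite mulf_eq0 => /orP[/eqP//|/eqP h].
(* The roots 0 and (1 - c) / c of u (c u - (1 - c)) are simple, so the
   derivative 2 c u - (1 - c) of the quadratic does not vanish there. *)
have /eqP := two_values x Ix; rewrite mulf_eq0 => /orP[] /eqP h'.
- suff d0 : 1 - c = 0 by rewrite d0 eqxx in c1.
  by rewrite h' !mulr0 in h; lra.
- suff d0 : 1 - c = 0 by rewrite d0 eqxx in c1.
  by lra.
Qed.

End ConstantAngle.

End UnitField.

(** * Ruled surfaces over their striction line *)

Lemma smooth_on_derive (R : realType) (I : set R) (f : R -> 'rV[R]_3) n s :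
  smooth_on I f -> I s -> is_derive s 1 (derive1n n f) (derive1n n.+1 f s).
Proof.
move=> [U [_ IU hU]] Is; rewrite derive1nS.
by apply: derivable_is_derive1; apply: hU; exact: IU.
Qed.

(** What the geometry of the surface uses at points of I, with g1 the
    derivative of gamma. *)
Record striction_data (R : realType) (I : set R)
    (gamma g1 w w1 w2 : R -> 'rV[R]_3) : Prop :=
  StrictionData {
    sd_field : unit_field I w w1 w2;
    sd_derive : forall s, I s -> is_derive s 1 gamma (g1 s);
    sd_derivable1 : forall s, I s -> derivable g1 s 1;
    sd_unit : forall s, I s -> dot (g1 s) (g1 s) = 1;
    sd_striction : forall s, I s -> dot (g1 s) (w1 s) = 0
  }.

Lemma noncylindrical_striction_data (R : realType) (I : set R)
    (gamma w : R -> 'rV[R]_3) :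
  noncylindrical_ruled I gamma w ->
  striction_data I gamma (derive1 gamma) w (derive1 w) (derive1 (derive1 w)).
Proof.
move=> [itv [hg hw] unit strict _]; split; first split.
- exact: itv.
- by move=> s /unit[_ /enorm1_dot w1]; exact: w1.
- by move=> s /strict[w0 _]; exact: w0.
- move=> s; exact: (smooth_on_derive 0 hw).
- move=> s; exact: (smooth_on_derive 1 hw).
- by move=> s Is; case: (smooth_on_derive 2 hw Is).
- move=> s; exact: (smooth_on_derive 0 hg).
- by move=> s Is; case: (smooth_on_derive 1 hg Is).
- by move=> s /unit[/enorm1_dot g1 _]; exact: g1.
- by move=> s /strict[_ gw]; exact: gw.
Qed.

Section RuledSurface.
Context {R : realType} (I : set R) (gamma g1 w w1 w2 : R -> 'rV[R]_3).
Local Notation V := 'rV[R]_3.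
Implicit Types (s t lam : R) (v : V) (N : R * R -> V).
Local Notation X := (ruled gamma w).
Local Notation D := (ruled_domain I).
Local Notation e := (binormal w w1).
Local Notation kappa := (geodesic_curvature w w1 w2).

Hypothesis hX : striction_data I gamma g1 w w1 w2.

Let hw : unit_field I w w1 w2 := sd_field hX.

Lemma ruled_partial1 s t : I s -> partial1 X (s, t) = g1 s + t *: w1 s.
Proof.
move=> Is; rewrite /partial1/= derive1E.
have h := is_deriveD (sd_derive hX Is) (is_deriveZ t (uf_derive hw Is)).
exact: (@derive_val _ _ _ _ _ _ _ h).
Qed.

Lemma is_derive_line (a b : V) t :
  is_derive t 1 (fun x : R => a + x *: b) b.
Proof.
have h := is_deriveD (is_derive_cst a t 1)
  (is_derive_scale (is_derive_id t 1) (is_derive_cst b t 1)).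
by apply: is_derive_eq h _; rewrite scale1r scaler0 addr0 add0r.
Qed.

Lemma ruled_partial2 : partial2 X = (fun p => w p.1).
Proof.
apply/funext => p; rewrite /partial2/ruled/= derive1E.
exact: (@derive_val _ _ _ _ _ _ _ (is_derive_line _ _ _)).
Qed.

Lemma ruled_partial21 s t : I s -> partial2 (partial1 X) (s, t) = w1 s.
Proof.
move=> Is; rewrite /partial2/=.
under [X in derive1 X]eq_fun do rewrite ruled_partial1//.
by rewrite derive1E; exact: (@derive_val _ _ _ _ _ _ _ (is_derive_line _ _ _)).
Qed.

Lemma ruled_partial22 p : partial2 (partial2 X) p = 0.
Proof. by rewrite ruled_partial2 /partial2/= derive1_cst. Qed.

Lemma ruled_cross s t : I s ->
  cross (partial1 X (s, t)) (partial2 X (s, t)) =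
  cross (g1 s) (w s) + t *: cross (w1 s) (w s).
Proof.
by move=> Is; rewrite ruled_partial1// ruled_partial2 /= crossDl crossZl.
Qed.

Lemma dot_cross_striction s :
  I s -> dot (cross (g1 s) (w s)) (cross (w1 s) (w s)) = 0.
Proof.
move=> Is; rewrite dot_cross_crossr (sd_striction hX)// [dot (w1 s) _]dotC.
by rewrite (dot_w_w1 hw)//; ring.
Qed.

(** No term linear in t appears because gamma' x w and w' x w are orthogonal;
    this is where the striction condition enters. *)
Lemma ruled_area s t : I s ->
  let n := cross (partial1 X (s, t)) (partial2 X (s, t)) in
  dot n n = dot (cross (g1 s) (w s)) (cross (g1 s) (w s))
     + dot (w1 s) (w1 s) * t ^+ 2.
Proof.
move=> Is n; rewrite /n ruled_cross// dotDl !dotDr !dotZl !dotZr.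
rewrite [dot (cross (w1 s) _) (cross (g1 s) _)]dotC dot_cross_striction//.
rewrite [dot (cross (w1 s) _) _]dot_cross_cross (uf_unit hw)//.
by rewrite [dot (w1 s) (w s)]dotC (dot_w_w1 hw)//; ring.
Qed.

(** The second fundamental form has g = 0, so only f^2 = <w', n>^2 / |n|^2
    survives. By the striction condition gamma' x w is parallel to w', which
    turns <w', gamma' x w>^2 into |gamma' x w|^2 |w'|^2. *)
Lemma ruled_gauss_curvature s t : I s ->
  let n := cross (partial1 X (s, t)) (partial2 X (s, t)) in
  gauss_curvature X (s, t) =
  - (dot (cross (g1 s) (w s)) (cross (g1 s) (w s)) * dot (w1 s) (w1 s))
    / dot n n ^+ 2.
Proof.
move=> Is n; rewrite /gauss_curvature ruled_partial22 dot0l mulr0 sub0r.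
rewrite ruled_partial21// -dot_cross_cross /param_normal -/n.
rewrite dotZr exprMn exprVn sqr_enorm.
have -> : dot (w1 s) n = dot (w1 s) (cross (g1 s) (w s)).
  by rewrite /n ruled_cross// dotDr dotZr [X in _ * X]dotC dot_crossl mulr0 addr0.
have -> : dot (w1 s) (cross (g1 s) (w s)) ^+ 2 =
    dot (cross (g1 s) (w s)) (cross (g1 s) (w s)) * dot (w1 s) (w1 s).
  apply/eqP; rewrite eq_sym -subr_eq0 [dot (w1 s) (cross _ _)]dotC.
  rewrite -dot_cross_cross cross_cross (sd_striction hX)// (dot_w_w1 hw)//.
  by rewrite !scale0r subr0 dot0l.
by rewrite [dot n n ^+ 2]expr2 invfM; ring.
Qed.

(** The square of the translator equation on the ruling through s is the
    identity of [translator_polynomial] with D = |gamma' x w|^2 |w'|^2. *)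
Lemma translator_cross_eq0 N v lam s :
  translator D X N v lam -> I s -> cross (g1 s) (w s) = 0.
Proof.
move=> [[_ hN] hK] Is.
have B0 : 0 < dot (w1 s) (w1 s) by rewrite dot_gt0 (uf_neq0 hw).
set c := cross (g1 s) (w s); set B := dot (w1 s) (w1 s) in B0.
have A0 : 0 <= dot c c by exact: dot_ge0.
suff : dot c c * B = 0.
  by move/eqP; rewrite mulf_eq0 (gt_eqF B0) orbF dot_eq0 => /eqP.
apply: (translator_polynomial (A := dot c c) (B := B) (a := dot c v)
  (b := dot (cross (w1 s) (w s)) v) (lam := lam)); first by rewrite gt_eqF.
move=> t; set P := dot c c + B * t ^+ 2.
have nP := ruled_area t Is; rewrite /= -/c -/B -/P in nP.
(* P vanishes only if A = 0 and t = 0; the identity is then trivial. *)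
have [P0|P0] := eqVneq P 0.
  have -> : dot c c = 0.
    by have := sqr_ge0 t; rewrite /P in P0; nra.
  by rewrite P0; ring.
have reg : regular_points D X (s, t).
  by split; [split|rewrite -dot_eq0 nP].
have [/enorm1_dot N1 Ns Nt] := hN _ reg.
have := sqr_dot_normal v N1 Ns Nt.
have := hK _ reg; rewrite ruled_gauss_curvature// nP ruled_cross// dotDl dotZl.
rewrite -/c -/B; set x := dot (N (s, t)) v => hx hs.
have -> : dot c c * B + lam * P ^+ 2 = - x * P ^+ 2.
  have -> : x = - (dot c c * B) / P ^+ 2 - lam by rewrite hx; ring.
  by field.
rewrite mulrC [t * _]mulrC in hs *; rewrite -hs; ring.
Qed.

Lemma tangent_surfaceP :
  (forall s, I s -> exists c : R, w s = c *: g1 s) <->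
  forall s, I s -> cross (g1 s) (w s) = 0.
Proof.
split=> h s Is.
  have [c ->] := h s Is; exact: cross_parallel.
exists (dot (g1 s) (w s)); apply: cross0_parallel (h s Is).
exact: (sd_unit hX).
Qed.

Section Tangent.
Hypothesis tangent : forall s, I s -> cross (g1 s) (w s) = 0.

Lemma tangent_g1 s : I s -> g1 s = dot (w s) (g1 s) *: w s.
Proof.
move=> Is; apply: cross0_parallel; first exact: (uf_unit hw).
by rewrite crossC tangent// oppr0.
Qed.

Lemma tangent_sqr_dot s v : I s -> dot (g1 s) v ^+ 2 = dot (w s) v ^+ 2.
Proof.
move=> Is; have := sd_unit hX Is; rewrite (tangent_g1 Is).
by rewrite !dotZl !dotZr (uf_unit hw)// exprMn => h; rewrite expr2; nra.
Qed.

Lemma tangent_gauss_curvature s t : I s -> gauss_curvature X (s, t) = 0.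
Proof.
by move=> Is; rewrite ruled_gauss_curvature// tangent// dot0l mul0r oppr0 mul0r.
Qed.

Lemma tangent_regular s t : I s -> t != 0 -> regular_points D X (s, t).
Proof.
move=> Is t0; split; first by split.
rewrite -dot_eq0 (ruled_area t Is) tangent// dot0l add0r mulf_neq0 ?sqrf_eq0//.
by rewrite dot_eq0 (uf_neq0 hw).
Qed.

(** A vanishing geodesic curvature makes e constant; w, and hence gamma', is
    then orthogonal to a fixed vector. *)
Lemma tangent_geodesic_planar :
  (forall s, I s -> kappa s = 0) -> in_plane (X @` D).
Proof.
move=> k0; have [_ [s0 [_ [Is0 _ _]]]] := (uf_interval hw).
have econst s : I s -> e s = e s0.
  by move=> Is; exact: (geodesic_binormal_const hw).
have we s : I s -> dot (w s) (e s0) = 0.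
  by move=> Is; rewrite -(econst _ Is) dotC dot_binormal_w.
exists (e s0), (dot (gamma s0) (e s0)); split.
  rewrite -dot_eq0 (binormal_unit hw Is0).
  exact: oner_neq0.
move=> _ [[s t] [/= Is _] <-]; rewrite /ruled/= dotDl dotZl we// mulr0 addr0.
apply: (derive0_const (f := fun x => dot (gamma x) (e s0)))
  (uf_interval hw).1 _ _ _ Is Is0.
move=> x Ix; apply: is_derive_eq (is_derive_dot_const _ (sd_derive hX Ix)) _.
by rewrite tangent_g1// dotZl we// mulr0.
Qed.

Lemma tangent_nongeodesic : ~ in_plane (X @` D) ->
  exists2 s, I s & kappa s != 0.
Proof.
move=> np; apply: contrapT => h; apply: np.
apply: tangent_geodesic_planar => s Is; apply/eqP/negPn/negP => ks.
by apply: h; exists s.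
Qed.

Lemma tangent_sqr_normal N v s t : orientation D X N -> I s -> t != 0 ->
  dot (N (s, t)) v ^+ 2 = dot (e s) v ^+ 2.
Proof.
move=> [_ hN] Is t0.
have [/enorm1_dot N1 Ns Nt] := hN _ (tangent_regular Is t0).
have := sqr_dot_normal v N1 Ns Nt; rewrite (ruled_area t Is) ruled_cross//.
have e1 := binormal_unit hw Is.
have := sqr_dot_normal v e1 (dot_binormal_w w w1 s) (dot_binormal_w1 w w1 s).
rewrite (dot_cross_w hw Is).
rewrite tangent// dot0l !add0r dotZl crossC.
rewrite dotNl sqrrN exprMn => <-.
have B0 : dot (w1 s) (w1 s) != 0 by rewrite dot_eq0 (uf_neq0 hw).
have t20 : t ^+ 2 != 0 by rewrite sqrf_eq0.
by move=> h; apply: (mulIf (mulf_neq0 B0 t20)); rewrite h; ring.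
Qed.

(** The sign relating gamma' to w is only known pointwise, so the argument goes
    through the square of <gamma',v>. *)
Lemma tangent_level_const v k :
  (forall s, I s -> dot (w s) v ^+ 2 = k) ->
  forall s t, I s -> I t -> dot (g1 s) v = dot (g1 t) v.
Proof.
move=> hk s t Is It.
apply: (derive0_const (f := fun r => dot (g1 r) v)) (uf_interval hw).1 _ _ _ Is It.
move=> r Ir.
have hg := is_derive_dot_const v (derivable_is_derive1 (sd_derivable1 hX Ir)).
apply: (is_derive_eq hg); apply: (derive_of_const_sqr (uf_interval hw) Ir hg) => x Ix.
by rewrite tangent_sqr_dot//; exact: hk.
Qed.

(** The binormal e is used as the normal field on both sheets t > 0 and t < 0;
    <e,v> is constant because <w',v> = 0. *)
Lemma tangent_helix_translator v k :
  (forall s, I s -> dot (g1 s) v = k) -> exists N lam, translator D X N v lam.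
Proof.
move=> hk; have [_ [s0 [_ [Is0 _ _]]]] := uf_interval hw.
have w1v s : I s -> dot (w1 s) v = 0.
  move=> Is; apply: (derive_of_const_sqr (uf_interval hw) Is
    (is_derive_dot_const v (uf_derive hw Is))) => x Ix.
  by rewrite -tangent_sqr_dot// hk.
have ev s : I s -> dot (e s) v = dot (e s0) v.
  move=> Is; apply: (derive0_const (f := fun r => dot (e r) v))
    (uf_interval hw).1 _ _ _ Is Is0 => r Ir.
  by apply: is_derive_eq (is_derive_binormal_dot hw v Ir) _; rewrite w1v// mulr0.
exists (fun p => e p.1), (- dot (e s0) v); split; first split.
- apply: continuous_in_subspaceT => p /set_mem[[/= Ip _] _].
  have [de hde] := binormal_derivable hw Ip.
  apply: (@continuous_comp _ _ _ fst e); first exact: cvg_fst.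
  exact: is_derive_continuous hde.
- move=> [s t] [[/= Is _] _]; split.
  + exact: dot1_enorm (binormal_unit hw Is).
  + rewrite ruled_partial1// dotDr dotZr dot_binormal_w1 mulr0 addr0.
    by rewrite tangent_g1// dotZr dot_binormal_w mulr0.
  + by rewrite ruled_partial2 dot_binormal_w.
- move=> [s t] [[/= Is _] _].
  by rewrite tangent_gauss_curvature//= ev// subrr.
Qed.

End Tangent.

(** Comparing the translator equation at t = 1, where K = 0, with the binormal
    gives <e,v>^2 = lam^2; a surface outside every plane has a point of
    nonzero geodesic curvature, from which the level property of w spreads. *)
Lemma translator_level N v lam :
  dot v v = 1 -> ~ in_plane (X @` D) -> translator D X N v lam ->
  [/\ lam != 0, lam ^+ 2 <= 1 & forall s, I s -> dot (w1 s) v = 0].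
Proof.
move=> v1 np tr; have [orient curv] := tr.
have tangent s : I s -> cross (g1 s) (w s) = 0 by exact: translator_cross_eq0 tr.
have ev s : I s -> dot (e s) v ^+ 2 = lam ^+ 2.
  move=> Is; rewrite -(tangent_sqr_normal tangent v orient Is (oner_neq0 R)).
  have := curv _ (tangent_regular tangent Is (oner_neq0 R)).
  by rewrite tangent_gauss_curvature// => h; rewrite -[RHS]sqrrN; congr (_ ^+ 2); lra.
have [s0 Is0 k0] := tangent_nongeodesic tangent np.
have [l0 hv] := nongeodesic_level hw v1 ev Is0 k0.
split=> //; first by rewrite -sqrf_eq0.
have [_ h] := sqr_geodesic_curvature hw v1 ev Is0 k0.
by rewrite -subr_ge0 -h mulr_ge0// sqr_ge0.
Qed.

End RuledSurface.

(** * The classification *)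

Theorem theorem2p2 (R : realType) (v : 'rV[R]_3) (I : set R)
    (gamma w : R -> 'rV[R]_3)
    (hv : enorm v = 1) (hruled : noncylindrical_ruled I gamma w) :
  ((exists (N : R * R -> 'rV[R]_3) (lam : R),
       translator (ruled_domain I) (ruled gamma w) N v lam) <->
   (tangent_surface I gamma w /\ general_helix I gamma v)) /\
  (forall (N : R * R -> 'rV[R]_3) (lam : R),
     translator (ruled_domain I) (ruled gamma w) N v lam ->
     (forall p, regular_points (ruled_domain I) (ruled gamma w) p ->
        gauss_curvature (ruled gamma w) p = 0) /\
     lam != 0 /\ lam \in `[-1, 1]).
Proof.
have hX := noncylindrical_striction_data hruled.
have np : ~ in_plane (ruled gamma w @` ruled_domain I) by case: hruled.
have v1 := enorm1_dot hv.
have [_ [s0 [_ [Is0 _ _]]]] := uf_interval (sd_field hX).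
split; [split|].
- move=> [N [lam tr]].
  have tangent s : I s -> cross (derive1 gamma s) (w s) = 0.
    exact: (translator_cross_eq0 hX tr).
  split; first exact: ((tangent_surfaceP hX).2 tangent).
  have [_ _ level] := translator_level hX v1 np tr.
  have wv s : I s -> dot (w s) v ^+ 2 = dot (w s0) v ^+ 2.
    move=> Is; congr (_ ^+ 2).
    apply: (derive0_const (f := fun r => dot (w r) v))
      (uf_interval (sd_field hX)).1 _ _ _ Is Is0 => r Ir.
    rewrite -(level r Ir); apply: is_derive_dot_const.
    exact: uf_derive (sd_field hX) _ Ir.
  exists (angle (derive1 gamma s0) v) => s Is.
  rewrite (angle_unit (sd_unit hX Is) v1) (angle_unit (sd_unit hX Is0) v1).
  by congr acos; exact: (tangent_level_const hX tangent wv Is Is0).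
- move=> [/(tangent_surfaceP hX) tangent [theta helix]].
  apply: (tangent_helix_translator hX tangent (k := cos theta)) => s Is.
  by rewrite -(helix s Is) (cos_angle_unit (sd_unit hX Is) v1).
- move=> N lam tr; have [l0 l1 _] := translator_level hX v1 np tr.
  split.
    move=> [s t] [[/= Is _] _].
    apply: (tangent_gauss_curvature hX _ _ Is) => r Ir.
    exact: (translator_cross_eq0 hX tr Ir).
  split=> //; rewrite in_itv/= -ler_norml.
  by rewrite -(@expr_le1 _ 2)// real_normK ?num_real.
Qed.
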